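(* Let $H_X\in\mathbb{F}_2^{m_X\times n}$, $H_Z\in\mathbb{F}_2^{m_Z\times n}$ with $H_XH_Z^\top=0$, let $C=\ker(H_X)\cap\ker(H_Z)\subseteq\mathbb{F}_2^n$, and let $C^\perp$ be the dual of $C$ under the standard inner product on $\mathbb{F}_2^n$. Let $\bm w\in\mathbb{R}_{\ge0}^n$ be a vector of per-qubit directional weights and let $\alpha>0$. Define the global directional enumerator $\Gamma(\bm w;\alpha)=\sum_{v\in C}e^{\alpha\langle\bm w,v\rangle}$. Then $$\Gamma(\bm w;\alpha)=W_C(\{1,e^{\alpha w_i}\}_{i=1}^n)=\frac{1}{|C^\perp|}\sum_{u\in C^\perp}\prod_{i=1}^n\bigl(1+(-1)^{u_i}e^{\alpha w_i}\bigr).$$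
   Context: $W_C$ is the per-coordinate complete weight enumerator of $C$: $W_C(\{x_i,y_i\}_{i=1}^n)=\sum_{v\in C}\prod_{i=1}^n x_i^{1-v_i}y_i^{v_i}$, and $W_C(\{1,e^{\alpha w_i}\})$ denotes its value at $x_i=1$, $y_i=e^{\alpha w_i}$. Vectors $v\in\mathbb{F}_2^n$ are identified with elements of $\{0,1\}^n$, and $\langle\bm w,v\rangle=\sum_i w_iv_i$ is computed over the reals. The weights come from nonnegative matrices $D_X\in\mathbb{R}_{\ge0}^{n\times m_X}$, $D_Z\in\mathbb{R}_{\ge0}^{n\times m_Z}$ supported on the edges of the Tanner graphs (the entry $(i,j)$ may be nonzero only if $H_X(j,i)=1$, resp. $H_Z(j,i)=1$), via $w_i=\sum_{j:H_X(j,i)=1}D_X(i,j)+\sum_{j:H_Z(j,i)=1}D_Z(i,j)\ge0$. *)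

(* Defs.v *)
From mathcomp Require Import all_boot all_order all_algebra.
From mathcomp Require Import reals sequences exp.

Set Implicit Arguments.
Unset Strict Implicit.
Unset Printing Implicit Defensive.

Import GRing.Theory Num.Theory.
Local Open Scope ring_scope.

Definition bit (a : 'F_2) : nat := nat_of_ord a.

Definition common_kernel (mX mZ n : nat)
    (HX : 'M['F_2]_(mX, n)) (HZ : 'M['F_2]_(mZ, n)) : {set 'rV['F_2]_n} :=
  [set v : 'rV['F_2]_n | (HX *m v^T == 0) && (HZ *m v^T == 0)].

Definition dual_code (n : nat) (C : {set 'rV['F_2]_n}) : {set 'rV['F_2]_n} :=
  [set u : 'rV['F_2]_n | [forall v in C, \sum_(i < n) u 0 i * v 0 i == 0]].

Definition weight_enumerator (R : comNzRingType) (n : nat)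
    (C : {set 'rV['F_2]_n}) (x y : 'I_n -> R) : R :=
  \sum_(v in C) \prod_(i < n) (x i ^+ (1 - bit (v 0 i)) * y i ^+ bit (v 0 i)).

Definition real_pairing (R : realType) (n : nat)
    (w : 'rV[R]_n) (v : 'rV['F_2]_n) : R :=
  \sum_(i < n) w 0 i * (bit (v 0 i))%:R.

Definition directional_enumerator (R : realType) (n : nat)
    (C : {set 'rV['F_2]_n}) (w : 'rV[R]_n) (alpha : R) : R :=
  \sum_(v in C) expR (alpha * real_pairing w v).

(* The weights attached to the two Tanner graphs, [DX] and [DZ] being indexed
   by (qubit, check).  Only the entries lying on an edge are summed.  The next
   lemma shows that these weights are an instance of an arbitrary
   entrywise nonnegative [w]. *)
Definition tanner_weights (R : realType) (mX mZ n : nat)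
    (HX : 'M['F_2]_(mX, n)) (HZ : 'M['F_2]_(mZ, n))
    (DX : 'M[R]_(n, mX)) (DZ : 'M[R]_(n, mZ)) : 'rV[R]_n :=
  \row_(i < n) (\sum_(j < mX | HX j i == 1) DX i j
                + \sum_(j < mZ | HZ j i == 1) DZ i j).

Lemma tanner_weights_ge0 (R : realType) (mX mZ n : nat)
    (HX : 'M['F_2]_(mX, n)) (HZ : 'M['F_2]_(mZ, n))
    (DX : 'M[R]_(n, mX)) (DZ : 'M[R]_(n, mZ))
    (hDX : forall i j, 0 <= DX i j) (hDZ : forall i j, 0 <= DZ i j) (i : 'I_n) :
  0 <= tanner_weights HX HZ DX DZ 0 i.
Proof. by rewrite mxE addr_ge0 // sumr_ge0. Qed.

(* Main.v *)
(** The right-hand side expands into a sum over all [v] of the monomial of [v]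
    times the character sum of [(-1) ^ <u, v>] over [u] in the dual code.  That
    sum is the size of the dual code when [v] lies in the double dual, and
    otherwise vanishes by translation.  A common kernel equals its double dual
    without any dimension count, because the rows of the check matrices belong
    to the dual code. *)

Require Import Defs.
From mathcomp Require Import all_boot all_order all_algebra.
From mathcomp Require Import reals sequences exp.

Set Implicit Arguments.
Unset Strict Implicit.
Unset Printing Implicit Defensive.

Import GRing.Theory Num.Theory.
Local Open Scope ring_scope.

Definition dotF2 (n : nat) (u v : 'rV['F_2]_n) : 'F_2 :=
  \sum_(i < n) u 0 i * v 0 i.

Lemma dotF2C (n : nat) (u v : 'rV['F_2]_n) : dotF2 u v = dotF2 v u.
Proof. by apply: eq_bigr => i _; rewrite mulrC. Qed.

Lemma dotF2Dl (n : nat) (u u' v : 'rV['F_2]_n) :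
  dotF2 (u + u') v = dotF2 u v + dotF2 u' v.
Proof. by rewrite -big_split; apply: eq_bigr => i _; rewrite mxE mulrDl. Qed.

Lemma dotF2_row (m n : nat) (H : 'M['F_2]_(m, n)) (j : 'I_m) (v : 'rV['F_2]_n) :
  dotF2 (row j H) v = (H *m v^T) j 0.
Proof. by rewrite mxE; apply: eq_bigr => i _; rewrite !mxE. Qed.

Lemma dual_codeP (n : nat) (C : {set 'rV['F_2]_n}) (u : 'rV['F_2]_n) :
  reflect {in C, forall v, dotF2 u v = 0} (u \in dual_code C).
Proof.
by rewrite inE; apply: (iffP forall_inP) => uC v /uC; [move/eqP | move=> /eqP].
Qed.

Lemma dual_codeD (n : nat) (C : {set 'rV['F_2]_n}) (u u' : 'rV['F_2]_n) :
  u' \in dual_code C -> (u + u' \in dual_code C) = (u \in dual_code C).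
Proof.
move=> /dual_codeP u'C; apply/dual_codeP/dual_codeP => uC v vC;
  by move: (uC v vC); rewrite dotF2Dl u'C // addr0.
Qed.

Lemma row_dual_code (m n : nat) (H : 'M['F_2]_(m, n)) (C : {set 'rV['F_2]_n})
    (j : 'I_m) :
  {in C, forall v, H *m v^T = 0} -> row j H \in dual_code C.
Proof. by move=> HC; apply/dual_codeP => v /HC Hv; rewrite dotF2_row Hv mxE. Qed.

Lemma dual_code_common_kernel (mX mZ n : nat)
    (HX : 'M['F_2]_(mX, n)) (HZ : 'M['F_2]_(mZ, n)) :
  dual_code (dual_code (common_kernel HX HZ)) = common_kernel HX HZ.
Proof.
apply/setP => v; apply/idP/idP => [/dual_codeP vD|vC]; last first.
  by apply/dual_codeP => u /dual_codeP uC; rewrite dotF2C uC.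
have kerP m (H : 'M['F_2]_(m, n)) :
    {in common_kernel HX HZ, forall v, H *m v^T = 0} -> H *m v^T == 0.
  move=> HC; apply/eqP/colP => j.
  by rewrite -dotF2_row dotF2C vD ?row_dual_code // mxE.
by rewrite inE !kerP // => v'; rewrite inE => /andP[/eqP ? /eqP ?].
Qed.

Lemma F2_cases (a : 'F_2) : a = 0 \/ a = 1.
Proof. by case: a => [[|[|//]] a2]; [left|right]; apply: val_inj. Qed.

(** The exponents differ only when both bits are 1, where they are 0 and 2; parity is all that
    matters for a sign. *)
Lemma sign_bitD (R : comNzRingType) (a b : 'F_2) :
  (-1) ^+ bit (a + b) = (-1) ^+ bit a * (-1) ^+ bit b :> R.
Proof.
by case: (F2_cases a) (F2_cases b) => -> [] ->;
  rewrite -signr_odd -exprD -[RHS]signr_odd.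
Qed.

Lemma sign_bitM (R : comNzRingType) (a b : 'F_2) :
  (-1) ^+ bit (a * b) = ((-1) ^+ bit a) ^+ bit b :> R.
Proof.
by case: (F2_cases b) => ->; rewrite ?mulr0 ?mulr1 ?expr0 ?expr1.
Qed.

Lemma sign_bit_dotF2 (R : comNzRingType) (n : nat) (u v : 'rV['F_2]_n) :
  (-1) ^+ bit (dotF2 u v) = \prod_(i < n) ((-1) ^+ bit (u 0 i)) ^+ bit (v 0 i)
    :> R.
Proof.
rewrite (big_morph _ (@sign_bitD R) (expr0 _ : (-1) ^+ bit 0 = 1)).
by apply: eq_bigr => i _; rewrite sign_bitM.
Qed.

Lemma prod_sum_rV (R : comNzRingType) (n : nat) (J : finType)
    (F : 'I_n -> J -> R) :
  \prod_(i < n) \sum_(a : J) F i a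
    = \sum_(v : 'rV[J]_n) \prod_(i < n) F i (v 0 i).
Proof.
(* Distributivity yields a sum over finite functions, carried to row vectors by the evident
   bijection. *)
rewrite bigA_distr_bigA (reindex (fun v : 'rV[J]_n => [ffun i => v 0 i])) /=.
  by apply: eq_bigr => v _; apply: eq_bigr => i _; rewrite ffunE.
exists (fun f : {ffun 'I_n -> J} => \row_i f i) => [v _ | f _].
  by apply/rowP => i; rewrite mxE ffunE.
by apply/ffunP => i; rewrite ffunE mxE.
Qed.

Lemma prod_sign_bit_expand (R : comNzRingType) (n : nat) (x y : 'I_n -> R)
    (u : 'rV['F_2]_n) :
  \prod_(i < n) (x i + (-1) ^+ bit (u 0 i) * y i)
    = \sum_(v : 'rV['F_2]_n) (-1) ^+ bit (dotF2 u v) *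
        \prod_(i < n) (x i ^+ (1 - bit (v 0 i)) * y i ^+ bit (v 0 i)).
Proof.
under [RHS]eq_bigr => v _ do rewrite sign_bit_dotF2 -big_split /=.
(* With the sign split by coordinate, each summand is a product of local factors. Refolding leaves
   in coordinate [i] a sum over one bit [a], whose values 0 and 1 give the two terms on the left. *)
rewrite -(prod_sum_rV (fun i a =>
  ((-1) ^+ bit (u 0 i)) ^+ bit a * (x i ^+ (1 - bit a) * y i ^+ bit a))).
apply: eq_bigr => i _.
by rewrite big_ord_recl big_ord1 /= !expr0 !expr1 !mul1r mulr1.
Qed.

(** Orthogonality of characters: if some [u0] in the dual code pairs to 1 with [v], translation by
    [u0] permutes the dual code and flips every sign. *)
Lemma dual_code_sign_sum (R : numDomainType) (n : nat) (C : {set 'rV['F_2]_n})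
    (v : 'rV['F_2]_n) :
  \sum_(u in dual_code C) (-1) ^+ bit (dotF2 u v)
    = if v \in dual_code (dual_code C) then #|dual_code C|%:R else 0 :> R.
Proof.
case: ifPn => [/dual_codeP vD | ].
  rewrite -sumr_const; apply: eq_bigr => u uD.
  by rewrite dotF2C vD // expr0.
rewrite inE => /forall_inPn [u0 u0D /negP vu0].
have {vu0} u0v : dotF2 u0 v = 1.
  by rewrite dotF2C; case: (F2_cases (dotF2 v u0)) => // /eqP /vu0.
(* Since [R] has characteristic zero, it suffices that the sum equals its own opposite. *)
apply/eqP; rewrite -[_ == 0](mulrn_eq0 _ 2) mulr2n addr_eq0; apply/eqP.
rewrite [LHS](reindex_inj (addIr u0)) -sumrN /=.
apply: eq_big => [u | u _]; first by rewrite dual_codeD.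
by rewrite dotF2Dl u0v sign_bitD expr1 mulrN1.
Qed.

(** The double dual appears because it is the set that the character sum detects. *)
Lemma macwilliams (R : numFieldType) (n : nat) (C : {set 'rV['F_2]_n})
    (x y : 'I_n -> R) :
  weight_enumerator (dual_code (dual_code C)) x y
    = (#|dual_code C|%:R)^-1
      * \sum_(u in dual_code C)
          \prod_(i < n) (x i + (-1) ^+ bit (u 0 i) * y i).
Proof.
(* The zero vector lies in the dual code, so the denominator can be cleared. *)
have D_neq0 : #|dual_code C|%:R != 0 :> R.
  rewrite pnatr_eq0 -lt0n; apply/card_gt0P; exists 0.
  by apply/dual_codeP => v _; rewrite /dotF2 big1 // => i _; rewrite mxE mul0r.
apply: (mulfI D_neq0); rewrite mulVKf //.
under [RHS]eq_bigr => u _ do rewrite prod_sign_bit_expand.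
(* Both sides become sums over all [v], the left one padded by zeros outside the double dual. *)
rewrite exchange_big /= /weight_enumerator mulr_sumr big_mkcond /=.
apply: eq_bigr => v _; rewrite -mulr_suml dual_code_sign_sum.
by case: ifP => _; rewrite ?mul0r.
Qed.

Lemma directional_enumeratorE (R : realType) (n : nat) (C : {set 'rV['F_2]_n})
    (w : 'rV[R]_n) (alpha : R) :
  directional_enumerator C w alpha
    = weight_enumerator C (fun _ : 'I_n => 1)
        (fun i : 'I_n => expR (alpha * w 0 i)).
Proof.
(* The exponential turns the pairing into a product, and each bit, read as a real factor, into an
   exponent. *)
apply: eq_bigr => v _; rewrite mulr_sumr expR_sum; apply: eq_bigr => i _.
by rewrite expr1n mul1r mulrA -expRM_natr.
Qed.

Theorem theorem1 (R : realType) (mX mZ n : nat)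
    (HX : 'M['F_2]_(mX, n)) (HZ : 'M['F_2]_(mZ, n))
    (hH : HX *m HZ^T = 0)
    (w : 'rV[R]_n) (hw : forall i : 'I_n, 0 <= w 0 i)
    (alpha : R) (halpha : 0 < alpha) :
  let C := common_kernel HX HZ in
  directional_enumerator C w alpha
    = weight_enumerator C (fun _ : 'I_n => 1)
        (fun i : 'I_n => expR (alpha * w 0 i))
  /\
  weight_enumerator C (fun _ : 'I_n => 1)
        (fun i : 'I_n => expR (alpha * w 0 i))
    = (#|dual_code C|%:R)^-1
      * \sum_(u in dual_code C)
          \prod_(i < n) (1 + (-1) ^+ bit (u 0 i) * expR (alpha * w 0 i)).
Proof.
move=> C; split; first exact: directional_enumeratorE.
(* Only the code on the left is replaced by its double dual; the right side keeps the dual of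
   [C]. *)
by rewrite -{1}[C]dual_code_common_kernel macwilliams.
Qed.
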